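(* $\mathcal{SCP} \subset \mathcal{MC}$, the inclusion being proper.
   Context: An implicator groupoid is an algebra $\mathbf A = \langle A, \to, 0 \rangle$, with $\to$ binary and $0$ a constant, which, writing $x' := x \to 0$, satisfies the identities (I) $(x \to y) \to z \approx [(z' \to x) \to (y \to z)']'$ and (I$_0$) $0'' \approx 0$. Put $x \land y := (x \to y')'$. $\mathcal{SCP}$ is the variety of implicator groupoids satisfying $x \to y \approx y' \to x'$; $\mathcal{MC}$ is the variety of implicator groupoids satisfying $x \land y \approx y \land x$. *)

(* Defs.v *)
Set Implicit Arguments.
Unset Strict Implicit.

Declare Scope implicator_scope.
Delimit Scope implicator_scope with impl.
Reserved Notation "x ⇒ y" (at level 55, right associativity).

Section Operations.

Variables (T : Type) (imp : T -> T -> T) (zero : T).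
Local Notation "x ⇒ y" := (imp x y).

Definition neg_op (x : T) : T := x ⇒ zero.

Definition identity_I : Prop :=
  forall x y z : T,
    (x ⇒ y) ⇒ z = neg_op ((neg_op z ⇒ x) ⇒ neg_op (y ⇒ z)).

Definition identity_I0 : Prop := neg_op (neg_op zero) = zero.

End Operations.

Record implicator_groupoid : Type := ImplicatorGroupoid {
  carrier :> Type;
  imp : carrier -> carrier -> carrier;
  zero : carrier;
  implicator_I : identity_I imp zero;
  implicator_I0 : identity_I0 imp zero
}.

Arguments imp {i} _ _.
Arguments zero {i}.

Notation "x ⇒ y" := (imp x y) : implicator_scope.
Local Open Scope implicator_scope.

Definition neg (A : implicator_groupoid) (x : A) : A := x ⇒ zero.

Definition meet (A : implicator_groupoid) (x y : A) : A := neg (x ⇒ neg y).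

(* A variety of implicator groupoids is represented by the class of its
   members, as a predicate on [implicator_groupoid]. *)
Definition SCP (A : implicator_groupoid) : Prop :=
  forall x y : A, x ⇒ y = neg y ⇒ neg x.

Definition MC (A : implicator_groupoid) : Prop :=
  forall x y : A, meet x y = meet y x.

Definition subclass (V W : implicator_groupoid -> Prop) : Prop :=
  forall A : implicator_groupoid, V A -> W A.

Definition proper_subclass (V W : implicator_groupoid -> Prop) : Prop :=
  subclass V W /\ exists A : implicator_groupoid, W A /\ ~ V A.

(* Main.v *)
Require Import Defs.

(** Inclusion.  Write x', x'', x''' for iterated negations.  If negation were
    involutive, strong contraposition would give x → y' = y'' → x' = y → x' at
    once, and meets would commute.  It need not be involutive, but meets only
    involve negated implications, and those are insensitive to replacing both
    arguments by their double negations: identity (I) with z = 0 says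
    (x → y)' = ((0' → x) → y'')', and contraposition turns 0' → x into
    x' → 0'' = x''.  Since moreover x''' = x', the extra negations on y' and x'
    can be dropped and restored at will:
    (x → y')' = (x'' → y''')' = (x'' → y')' = (y'' → x''')' = (y → x')'.

    Properness.  In an algebra where every negation is 0, all meets are 0 and
    contraposition forces every product x → y to be 0 → 0 = 0' = 0.  So a
    product that is not identically 0, but vanishes as soon as one factor is 0
    or is itself a product, separates the classes. *)

Local Open Scope implicator_scope.

Section StrongContraposition.

Variable A : implicator_groupoid.
Hypothesis contraposition : SCP A.

Lemma imp_neg_zero (x : A) : neg zero ⇒ x = neg (neg x).
Proof.
  rewrite (contraposition (neg zero) x).
  exact (f_equal (imp (neg x)) (implicator_I0 A)).
Qed.

(** Identity (I) at z = 0, whose inner antecedent 0' → x has just been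
    computed. *)
Lemma neg_imp_neg_neg (x y : A) :
  neg (x ⇒ y) = neg (neg (neg x) ⇒ neg (neg y)).
Proof.
  rewrite <- (imp_neg_zero x).
  exact (implicator_I x y zero).
Qed.

Lemma neg_neg_neg (x : A) : neg (neg (neg x)) = neg x.
Proof.
  rewrite <- (imp_neg_zero (neg x)).
  symmetry; exact (contraposition x zero).
Qed.

Lemma meet_comm_of_SCP (x y : A) : meet x y = meet y x.
Proof.
  unfold meet.
  rewrite (neg_imp_neg_neg x (neg y)), (neg_imp_neg_neg y (neg x)).
  rewrite (neg_neg_neg x), (neg_neg_neg y).
  rewrite (contraposition (neg (neg x)) (neg y)), (neg_neg_neg x).
  reflexivity.
Qed.

End StrongContraposition.

Inductive three : Type := Zero | Value | Generator.

(** The only nonzero product is that of [Generator] with itself; since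
    [Generator] is not a product, iterated products all vanish. *)
Definition square_imp (x y : three) : three :=
  match x, y with
  | Generator, Generator => Value
  | _, _ => Zero
  end.

Lemma square_imp_I : identity_I square_imp Zero.
Proof. intros [] [] []; reflexivity. Qed.

Definition square_groupoid : implicator_groupoid :=
  ImplicatorGroupoid square_imp_I (eq_refl : identity_I0 square_imp Zero).

Lemma square_groupoid_MC : MC square_groupoid.
Proof. intros [] []; reflexivity. Qed.

Lemma square_groupoid_not_SCP : ~ SCP square_groupoid.
Proof. intro contraposition; discriminate (contraposition Generator Generator). Qed.

Theorem theorem5p2 : proper_subclass SCP MC.
Proof.
  split.
  - exact meet_comm_of_SCP.
  - exists square_groupoid.
    exact (conj square_groupoid_MC square_groupoid_not_SCP).
Qed.
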